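(* Let $n\ge 2$ and $h\in\mathbb{F}$. Let $\mathfrak{R}'\subset\mathbb{P}(M_{n^2}(\mathbb{F}))=\mathbb{P}(\operatorname{End}(V_n\otimes V_n))$ be the set of (classes of) solutions of the modified quantum Yang-Baxter equation, and let $\overline{\mathfrak{R}'}$ be its Zariski closure. Then $R_{\mathfrak p}$ is a boundary solution of the Yang-Baxter equation, i.e. the class of $R_{\mathfrak p}$ lies in $\overline{\mathfrak{R}'}\setminus\mathfrak{R}'$.
   Context: $\mathbb{F}$ is an algebraically closed field of characteristic zero. $V_n$ is the space of polynomials in one variable of degree less than $n$, and $V_n\otimes V_n$ is identified with the polynomials in $z_1,z_2$ of degree less than $n$ in each variable. $R_{\mathfrak p}$ is the restriction to $V_n\otimes V_n$ of $$\tilde F_h-\frac{hn}{z_1-z_2+h}(\tilde F_h-P),$$ where $(\tilde F_hf)(z_1,z_2)=f(z_1+h,z_2-h)$ and $(Pf)(z_1,z_2)=f(z_2,z_1)$; this operator preserves $V_n\otimes V_n$. For a vector space $V$, a nonzero operator $R\in\operatorname{End}(V\otimes V)$ satisfies the modified quantum Yang-Baxter equation if $$R_{12}R_{13}R_{23}-R_{23}R_{13}R_{12}=\lambda\,(P_{123}R_{12}-P_{213}R_{23})$$ for some nonzero $\lambda\in\mathbb{F}$, where $R_{ij}$ acts as $R$ in the $i$-th and $j$-th tensor factors of $V^{\otimes3}$, and $P_{123}(v_1\otimes v_2\otimes v_3)=v_3\otimes v_1\otimes v_2$, $P_{213}(v_1\otimes v_2\otimes v_3)=v_2\otimes v_3\otimes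 v_1$. This condition is invariant under rescaling of $R$ by nonzero scalars (with $\lambda$ rescaled accordingly), so it defines a subset of projective space. Elements of $\overline{\mathfrak{R}'}\setminus\mathfrak{R}'$ are called boundary solutions of the Yang-Baxter equation. *)

(* Defs.v *)
From HB Require Import structures.
From mathcomp Require Import all_boot all_order all_algebra.
From mathcomp Require Import mpoly.

Set Implicit Arguments.
Unset Strict Implicit.
Unset Printing Implicit Defensive.

Import GRing.Theory.
Local Open Scope ring_scope.

(* Points of P(W) are the lines of W; "the class of x" is <[x]>. *)
Definition proj (F : fieldType) (W : vectType F) : Type :=
  {U : {vspace W} | \dim U == 1%N}.

(* For homogeneous p it suffices to test one nonzero x.  The coordinates are
   taken in the library's basis of W; another basis amounts to a linear change
   of variables in p, so the Zariski topology below does not depend on it. *)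
Definition vanishes_at (F : fieldType) (W : vectType F)
    (p : {mpoly F[\dim {:W}]}) (U : proj W) : Prop :=
  forall x : W, x \in val U -> p.@[fun i => coord (vbasis {:W}) i x] = 0.

Definition zariski_closed (F : fieldType) (W : vectType F)
    (A : proj W -> Prop) : Prop :=
  exists S : {mpoly F[\dim {:W}]} -> Prop,
    (forall p, S p -> exists d : nat, p \is d.-homog) /\
    (forall U, A U <-> (forall p, S p -> vanishes_at p U)).

Definition zariski_closure (F : fieldType) (W : vectType F)
    (A : proj W -> Prop) : proj W -> Prop :=
  fun U => forall B : proj W -> Prop,
    zariski_closed B -> (forall U', A U' -> B U') -> B U.

(* V = F^n with its standard basis e_0, ..., e_(n-1); a tensor in V^{(x)k} is
   the array of its coordinates in the basis of the e_i (x) e_j (x) ... .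
   F^o is F seen as a vector space over itself. *)
Definition vec (F : fieldType) (n : nat) := {ffun 'I_n -> F^o}.
Definition tensor2 (F : fieldType) (n : nat) := {ffun 'I_n * 'I_n -> F^o}.
Definition tensor3 (F : fieldType) (n : nat) :=
  {ffun 'I_n * 'I_n * 'I_n -> F^o}.

Section MQYBE.
Variables (F : fieldType) (n : nat).
Implicit Types (R : 'End({ffun 'I_n * 'I_n -> F^o})) (t : tensor3 F n).

(* R_{ab} applies R to the 2-tensor obtained by freezing the third index. *)
Definition R12 R t : tensor3 F n :=
  [ffun x => let: (i, j, k) := x in
     R [ffun y : 'I_n * 'I_n => t (y.1, y.2, k)] (i, j)].
Definition R13 R t : tensor3 F n :=
  [ffun x => let: (i, j, k) := x in
     R [ffun y : 'I_n * 'I_n => t (y.1, j, y.2)] (i, k)].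
Definition R23 R t : tensor3 F n :=
  [ffun x => let: (i, j, k) := x in
     R [ffun y : 'I_n * 'I_n => t (i, y.1, y.2)] (j, k)].

Definition P123 t : tensor3 F n :=
  [ffun x => let: (i, j, k) := x in t (j, k, i)].
Definition P213 t : tensor3 F n :=
  [ffun x => let: (i, j, k) := x in t (k, i, j)].

Definition tens2 (u v : vec F n) : tensor2 F n := [ffun x => u x.1 * v x.2].
Definition tens3 (u v w : vec F n) : tensor3 F n :=
  [ffun x => let: (i, j, k) := x in u i * v j * w k].

Fact P123_tens u v w : P123 (tens3 u v w) = tens3 w u v.
Proof.
by apply/ffunP=> -[[i j] k]; rewrite !ffunE mulrC mulrA.
Qed.

Fact P213_tens u v w : P213 (tens3 u v w) = tens3 v w u.
Proof.
by apply/ffunP=> -[[i j] k]; rewrite !ffunE -mulrA mulrC.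
Qed.

Definition mQYBE R : Prop :=
  R != 0 /\
  exists2 lambda : F, lambda != 0 &
    forall t : tensor3 F n,
      R12 R (R13 R (R23 R t)) - R23 R (R13 R (R12 R t))
      = lambda *: (P123 (R12 R t) - P213 (R23 R t)).

Definition mQYBE_locus (U : proj 'End({ffun 'I_n * 'I_n -> F^o})) : Prop :=
  exists2 R, val U = <[R]>%VS & mQYBE R.

(* The existence of U entails R != 0, so that R does have a class. *)
Definition boundary_solution R : Prop :=
  exists U : proj 'End({ffun 'I_n * 'I_n -> F^o}),
    [/\ val U = <[R]>%VS, zariski_closure mQYBE_locus U & ~ mQYBE_locus U].

End MQYBE.

(* Polynomials in z_1, z_2 are bivariate polynomials in {poly {poly F}}, with
   z_1 = 'X (outer variable) and z_2 = 'Y (inner variable). *)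
Section Rp.
Variables (F : fieldType) (n : nat) (h : F).
Implicit Types (f : {poly {poly F}}) (t : tensor2 F n).

(* f(z_1 + h, z_2 - h) *)
Definition Ftilde f : {poly {poly F}} :=
  map_poly (comp_poly ('X - h%:P)) f \Po ('X + h%:P%:P).

(* The divisor z_1 - z_2 + h is monic in z_1 and the division is exact, see
   Rp_divK. *)
Definition Rp_poly f : {poly {poly F}} :=
  Ftilde f - (h * n%:R)%:P%:P *
    ((Ftilde f - swapXY f) %/ ('X - 'Y + h%:P%:P)).

(* e_i (x) e_j corresponds to z_1^i z_2^j. *)
Definition poly_of_tensor t : {poly {poly F}} :=
  \sum_(x : 'I_n * 'I_n) (t x)%:P%:P * 'X^(x.1) * 'Y ^+ x.2.

Definition tensor_of_poly f : tensor2 F n := 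
  [ffun x : 'I_n * 'I_n => f`_(x.1)`_(x.2)].

(* Rp_fun is linear, see Rp_fun_linear, so linfun does not alter it. *)
Definition Rp_fun t : tensor2 F n :=
  tensor_of_poly (Rp_poly (poly_of_tensor t)).

Definition Rp : 'End({ffun 'I_n * 'I_n -> F^o}) := linfun Rp_fun.

Let d : {poly {poly F}} := 'X - 'Y + h%:P%:P.

Let dE : d = 'X - ('X - h%:P)%:P.
Proof. by rewrite /d polyCB opprB addrA addrAC. Qed.

Let d_monic : d \is monic.
Proof. by rewrite dE monicXsubC. Qed.

Let FtildeD : {morph Ftilde : f g / f + g}.
Proof. by move=> f g; rewrite /Ftilde rmorphD /= comp_polyD. Qed.

Let FtildeZ (a : F) f : Ftilde (a%:P%:P * f) = a%:P%:P * Ftilde f.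
Proof.
by rewrite /Ftilde rmorphM /= map_polyC /= comp_polyC comp_polyM comp_polyC.
Qed.

Let swapXYZ (a : F) f : swapXY (a%:P%:P * f) = a%:P%:P * swapXY f.
Proof. by rewrite rmorphM /= swapXY_polyC map_polyC. Qed.

Fact Rp_divK f :
  (Ftilde f - swapXY f) %/ ('X - 'Y + h%:P%:P) * ('X - 'Y + h%:P%:P)
  = Ftilde f - swapXY f.
Proof.
rewrite -/d; apply: Pdiv.IdomainUnit.divpK.
  by rewrite (monicP d_monic) unitr1.
rewrite dE dvdp_XsubCl; apply/rootP; rewrite hornerD hornerN.
apply/eqP; rewrite subr_eq0; apply/eqP.
elim/poly_ind: f => [|g a IHg].
  by rewrite /Ftilde rmorph0 comp_poly0 raddf0 horner0.
have -> : Ftilde (g * 'X + a%:P) =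
    Ftilde g * ('X + h%:P%:P) + (a \Po ('X - h%:P))%:P.
  by rewrite FtildeD /Ftilde rmorphM /= map_polyX map_polyC /= comp_polyM
    comp_polyX comp_polyC.
rewrite rmorphD rmorphM /= swapXY_X swapXY_polyC.
rewrite !hornerD !hornerM IHg !hornerE subrK.
by [].
Qed.

Let RpD : {morph Rp_poly : f g / f + g}.
Proof.
move=> f g; rewrite /Rp_poly FtildeD rmorphD /= opprD addrACA.
rewrite Pdiv.IdomainUnit.divpD ?(monicP d_monic) ?unitr1 //.
by rewrite mulrDr opprD addrACA.
Qed.

Let RpZ (a : F) f : Rp_poly (a%:P%:P * f) = a%:P%:P * Rp_poly f.
Proof.
rewrite /Rp_poly FtildeZ swapXYZ -mulrBr.
rewrite [X in X %/ _]mul_polyC.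
rewrite Pdiv.IdomainUnit.divpZl ?(monicP d_monic) ?unitr1 //.
by rewrite -mul_polyC [RHS]mulrBr [X in _ = _ - X]mulrCA.
Qed.

Let potD (a : F) t1 t2 : poly_of_tensor (a *: t1 + t2) =
  a%:P%:P * poly_of_tensor t1 + poly_of_tensor t2.
Proof.
rewrite /poly_of_tensor mulr_sumr -big_split /=; apply: eq_bigr => x _.
have -> : (a *: t1 + t2) x = a * t1 x + t2 x :> F by rewrite !ffunE.
by rewrite !polyCD !polyCM !mulrDl !mulrA.
Qed.

Fact Rp_fun_linear : linear Rp_fun.
Proof.
move=> a t1 t2; apply/ffunP=> x.
have -> : (a *: Rp_fun t1 + Rp_fun t2) x = a * Rp_fun t1 x + Rp_fun t2 x :> F.
  by rewrite !ffunE.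
rewrite /Rp_fun potD RpD RpZ !ffunE.
by move: (Rp_poly _) (Rp_poly _) => p q; rewrite !coefD !coefCM.
Qed.

Let coef_pot t (i j : nat) : (poly_of_tensor t)`_i`_j =
  \sum_(x : 'I_n * 'I_n) (t x *+ (i == x.1 :> nat)) *+ (j == x.2 :> nat).
Proof.
rewrite /poly_of_tensor !coef_sum; apply: eq_bigr => x _.
rewrite -rmorphXn /= coefMC coefCM coefXn.
case: (i == x.1); last by rewrite mulr0 mul0r coef0 !mul0rn.
by rewrite mulr1 coefCM coefXn mulr_natr.
Qed.

Let bounded f := forall i j : nat, (n <= i)%N || (n <= j)%N -> f`_i`_j = 0.

Let boundedP f :
  bounded f <-> (size f <= n)%N /\ (size (swapXY f) <= n)%N.
Proof.
split=> [fb|[/leq_sizeP f1 /leq_sizeP f2] i j].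
  split; apply/leq_sizeP=> i ni; apply/polyP=> j; rewrite coef0.
    by rewrite fb ?ni.
  by rewrite coef_swapXY fb ?ni ?orbT.
case/orP=> [/f1->|nj]; first by rewrite coef0.
by rewrite -coef_swapXY f2 ?coef0.
Qed.

Let bounded_pot t : bounded (poly_of_tensor t).
Proof.
move=> i j nij; rewrite coef_pot big1 // => -[x y] _ /=.
case: eqP => [ix|_]; last by rewrite mul0rn.
case: eqP => [jy|_]; last by [].
by move: nij; rewrite ix jy leqNgt (ltn_ord x) leqNgt (ltn_ord y).
Qed.

Let pot_of_bounded f : bounded f -> poly_of_tensor (tensor_of_poly f) = f.
Proof.
move=> fb; apply/polyP=> i; apply/polyP=> j; rewrite coef_pot.
have [ni|ni] := leqP n i.
  rewrite fb ?ni // big1 // => x _.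
  by rewrite gtn_eqF ?mul0rn // (leq_trans _ ni).
have [nj|nj] := leqP n j.
  rewrite fb ?nj ?orbT // big1 // => x _.
  by rewrite (gtn_eqF (leq_trans (ltn_ord x.2) nj)).
rewrite (bigD1 (Ordinal ni, Ordinal nj)) //= !eqxx ffunE big1 ?addr0 //.
move=> [x y] /=; rewrite -pair_eqE /= => xy.
have [ix|] := eqVneq i x; last by rewrite mul0rn.
have [jy|] := eqVneq j y; last by [].
by case/negP: xy; apply/andP; split; apply/eqP/val_inj.
Qed.

Let Ftilde_monomial (a : F) (k l : nat) :
  Ftilde (a%:P%:P * 'X^k * 'Y ^+ l) =
  a%:P%:P * (('X + h%:P) ^+ k)^:P * (('X - h%:P) ^+ l)%:P.
Proof.
rewrite -mulrA FtildeZ -mulrA; congr (_ * _).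
rewrite /Ftilde -rmorphXn /= rmorphM /= map_polyXn map_polyC /=.
rewrite comp_polyM comp_polyC comp_Xn_poly comp_Xn_poly.
by rewrite [in RHS]rmorphXn /= rmorphD /= map_polyX map_polyC.
Qed.

Let bounded_Ftilde t : bounded (Ftilde (poly_of_tensor t)).
Proof.
have Fsum I (r : seq I) (G : I -> {poly {poly F}}) :
    Ftilde (\sum_(i <- r) G i) = \sum_(i <- r) Ftilde (G i).
  apply: (big_morph _ FtildeD).
  by rewrite /Ftilde rmorph0 comp_poly0.
move=> i j nij; rewrite Fsum !coef_sum big1 // => x _.
rewrite Ftilde_monomial -mulrA coefCM coefMC coef_map /= !coefCM.
have sz (c : F) (k : 'I_n) m : (n <= m)%N -> (('X + c%:P) ^+ k)`_m = 0.
  move=> nm; apply: nth_default; apply: leq_trans nm.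
  by rewrite -[c]opprK polyCN size_exp_XsubC.
case/orP: nij => [ni|nj]; first by rewrite (sz h) ?mul0r ?mulr0.
by rewrite -polyCN (sz (- h)) ?mulr0.
Qed.

Let bounded_swap f : bounded f -> bounded (swapXY f).
Proof. by move=> fb i j nij; rewrite coef_swapXY fb // orbC. Qed.

Let boundedB f g : bounded f -> bounded g -> bounded (f - g).
Proof. by move=> fb gb i j nij; rewrite !coefB fb ?gb ?subr0. Qed.

Let size_factor f g : f != 0 -> (size f <= size (f * g)%R)%N || (g == 0).
Proof.
move=> f0; have [->|g0] := eqVneq g 0; first by rewrite orbT.
rewrite size_mul // orbF; move: g0; rewrite -size_poly_gt0.
by case: (size g) => // k _; rewrite addnS leq_addr.
Qed.

Let bounded_div f : bounded (f * d) -> bounded f.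
Proof.
move/boundedP=> [f1 f2]; apply/boundedP.
have [->|f0] := eqVneq f 0; first by rewrite raddf0 size_poly0.
have d0 : d != 0 by rewrite monic_neq0.
split.
  by apply: leq_trans f1; have:= size_factor d f0; rewrite (negPf d0) orbF.
apply: leq_trans f2; have sf0 : swapXY f != 0 by rewrite swapXY_eq0.
have:= size_factor (swapXY d) sf0.
by rewrite swapXY_eq0 (negPf d0) orbF rmorphM.
Qed.

(* The operator defining Rp_poly preserves V_n (x) V_n. *)
Fact Rp_polyE t : poly_of_tensor (Rp t) = Rp_poly (poly_of_tensor t).
Proof.
pose RpL := GRing.isLinear.Build F (tensor2 F n) (tensor2 F n) *:%R Rp_fun
  Rp_fun_linear.
pose RpLin : {linear _ -> _} := HB.pack Rp_fun RpL.
rewrite /Rp (lfunE RpLin) /= /Rp_fun pot_of_bounded // /Rp_poly.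
have bF := @bounded_Ftilde t.
apply: boundedB => // i j nij; rewrite !coefCM (bounded_div _) ?mulr0 //.
by rewrite Rp_divK; apply: boundedB => //; apply: bounded_swap.
Qed.

End Rp.

(* Main.v *)
From HB Require Import structures.
Require Import Defs.
From mathcomp Require Import all_boot all_order all_algebra.
From mathcomp Require Import mpoly ring.

Set Implicit Arguments.
Unset Strict Implicit.
Unset Printing Implicit Defensive.

Import GRing.Theory.
Local Open Scope ring_scope.

(** Put m = hn and R_c = R_p + cP.  In the shifted variables w_i = z_i + i h the
    operator P R_p becomes s + (m / (w_1 - w_2)) (s - 1), with s exchanging
    w_1 and w_2: an involution satisfying the braid relation.  Adding c to
    it turns the braid relation into the modified Yang-Baxter equation with
    lambda = - c^2.  So R_c lies in the locus for all but finitely many c, and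
    a polynomial vanishing on the locus vanishes at R_0 = R_p.  Conversely R_p
    satisfies the Yang-Baxter equation itself, so a multiple of R_p lies in the
    locus only if P_123 R_12 = P_213 R_23, which fails on the vector z_1. *)

(** * Tensors as polynomial functions, and the operators acting on their values *)

Section Evaluation.
Variables (F : fieldType) (n : nat).
Implicit Types (u : tensor2 F n) (t : tensor3 F n).
Implicit Types (R : 'End({ffun 'I_n * 'I_n -> F^o})).

Definition ev2 u (a b : F) : F := \sum_i \sum_j u (i, j) * a ^+ i * b ^+ j.

Definition ev3 t (a b c : F) : F :=
  \sum_i \sum_j \sum_k t (i, j, k) * a ^+ i * b ^+ j * c ^+ k.

Lemma ev2D u v a b : ev2 (u + v) a b = ev2 u a b + ev2 v a b.
Proof.
rewrite -big_split; apply: eq_bigr => i _; rewrite -big_split.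
by apply: eq_bigr => j _; rewrite ffunE !mulrDl.
Qed.

Lemma ev2Z k u a b : ev2 (k *: u) a b = k * ev2 u a b.
Proof.
rewrite /ev2 mulr_sumr; apply: eq_bigr => i _; rewrite mulr_sumr.
by apply: eq_bigr => j _; rewrite ffunE -!mulrA.
Qed.

Lemma ev3B s t a b c : ev3 (s - t) a b c = ev3 s a b c - ev3 t a b c.
Proof.
rewrite -sumrB; apply: eq_bigr => i _; rewrite -sumrB.
apply: eq_bigr => j _; rewrite -sumrB.
by apply: eq_bigr => k _; rewrite !ffunE !mulrBl.
Qed.

Lemma ev3Z l t a b c : ev3 (l *: t) a b c = l * ev3 t a b c.
Proof.
rewrite /ev3 mulr_sumr; apply: eq_bigr => i _; rewrite mulr_sumr.
apply: eq_bigr => j _; rewrite mulr_sumr.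
by apply: eq_bigr => k _; rewrite ffunE -!mulrA.
Qed.

Lemma ev3_slice12 t a b c :
  ev3 t a b c = \sum_k ev2 [ffun y => t (y.1, y.2, k)] a b * c ^+ k.
Proof.
rewrite /ev3; under eq_bigr do rewrite exchange_big.
rewrite exchange_big; apply: eq_bigr => k _; rewrite mulr_suml.
apply: eq_bigr => i _; rewrite mulr_suml.
by apply: eq_bigr => j _; rewrite ffunE.
Qed.

Lemma ev3_slice13 t a b c :
  ev3 t a b c = \sum_j ev2 [ffun y => t (y.1, j, y.2)] a c * b ^+ j.
Proof.
rewrite /ev3 exchange_big; apply: eq_bigr => j _; rewrite mulr_suml.
apply: eq_bigr => i _; rewrite mulr_suml.
by apply: eq_bigr => k _; rewrite ffunE mulrAC.
Qed.

Lemma ev3_slice23 t a b c :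
  ev3 t a b c = \sum_i ev2 [ffun y => t (i, y.1, y.2)] b c * a ^+ i.
Proof.
apply: eq_bigr => i _; rewrite mulr_suml.
apply: eq_bigr => j _; rewrite mulr_suml.
by apply: eq_bigr => k _; rewrite ffunE; ring.
Qed.

Lemma ev3_P123 t a b c : ev3 (P123 t) a b c = ev3 t b c a.
Proof.
rewrite /ev3 exchange_big; apply: eq_bigr => j _.
rewrite exchange_big; apply: eq_bigr => k _.
by apply: eq_bigr => i _; rewrite ffunE; ring.
Qed.

Lemma ev3_P213 t a b c : ev3 (P213 t) a b c = ev3 t c a b.
Proof.
rewrite /ev3; under eq_bigr do rewrite exchange_big.
rewrite exchange_big; apply: eq_bigr => k _; apply: eq_bigr => i _.
by apply: eq_bigr => j _; rewrite ffunE; ring.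
Qed.

Lemma ev2_poly u a b : ev2 u a b = (poly_of_tensor u).[a, b].
Proof.
rewrite /ev2 pair_bigA /poly_of_tensor !horner_sum.
apply: eq_bigr => -[i j] _.
by rewrite !(hornerM, hornerC, hornerXn, horner_exp, hornerX).
Qed.

Lemma horner_Ftilde h (f : {poly {poly F}}) a b :
  (Ftilde h f).[a, b] = f.[a + h, b - h].
Proof.
rewrite /Ftilde horner_comp !hornerE -polyCD.
rewrite -[X in (map_poly _ _).[X]](comp_polyC _ ('X - h%:P)).
by rewrite horner_map /= horner_comp !hornerE.
Qed.

(** Multiplying by the divisor turns the exact division into an identity of values, valid also where
    a - b + h = 0. *)
Lemma ev2_Rp h u a b :
  (a - b + h) * ev2 (Rp n h u) a b =
  (a - b + h - h * n%:R) * ev2 u (a + h) (b - h) + h * n%:R * ev2 u b a.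
Proof.
rewrite !ev2_poly Rp_polyE /Rp_poly.
have := congr1 (fun f => f.[a, b]) (Rp_divK h (poly_of_tensor u)).
move: (_ %/ _) => q; rewrite !hornerE horner2_swapXY !horner_Ftilde => E.
move: q.[a, b] (_.[a + h, _]) (_.[b, a]) E => Q G1 G2 E.
transitivity ((a - b + h) * G1 - h * n%:R * (Q * (a - b + h))); first by ring.
by rewrite E; ring.
Qed.

Definition flip u : tensor2 F n := [ffun x => u (x.2, x.1)].

Lemma flip_linear : linear flip.
Proof. by move=> k u v; apply/ffunP=> x; rewrite !ffunE. Qed.

HB.instance Definition _ := GRing.isLinear.Build F (tensor2 F n) (tensor2 F n)
  *:%R flip flip_linear.

Lemma ev2_flip u a b : ev2 (flip u) a b = ev2 u b a.
Proof.
rewrite /ev2 exchange_big; apply: eq_bigr => i _.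
by apply: eq_bigr => j _; rewrite ffunE mulrAC.
Qed.

Definition Rdeform h c : 'End({ffun 'I_n * 'I_n -> F^o}) :=
  Rp n h + c *: linfun flip.

Lemma ev2_Rdeform h c u a b :
  (a - b + h) * ev2 (Rdeform h c u) a b =
  (a - b + h - h * n%:R) * ev2 u (a + h) (b - h)
    + (h * n%:R + c * (a - b + h)) * ev2 u b a.
Proof.
rewrite /Rdeform add_lfunE scale_lfunE lfunE /= ev2D ev2Z ev2_flip mulrDr.
by rewrite ev2_Rp; ring.
Qed.

(** The common shape of R_p (c = 0) and R_c, with m = hn left as a free parameter. *)
Definition shift_swap h m c R : Prop := forall u a b,
  (a - b + h) * ev2 (R u) a b =
  (a - b + h - m) * ev2 u (a + h) (b - h) + (m + c * (a - b + h)) * ev2 u b a.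

(** * The modified Yang-Baxter equation at generic points *)

Section ShiftSwap.
Variables (h m c : F) (R : 'End({ffun 'I_n * 'I_n -> F^o})).
Hypothesis actR : shift_swap h m c R.

Let actV u a b : a - b + h != 0 -> ev2 (R u) a b =
  (a - b + h - m) / (a - b + h) * ev2 u (a + h) (b - h)
  + (m + c * (a - b + h)) / (a - b + h) * ev2 u b a.
Proof.
move=> nz; apply: (mulfI nz); rewrite actR.
by field.
Qed.

(** Expand t in powers of z: each coefficient is a 2-tensor in x and y, to which [actV] applies. *)
Lemma ev3_R12 t x y z : x - y + h != 0 -> ev3 (R12 R t) x y z =
  (x - y + h - m) / (x - y + h) * ev3 t (x + h) (y - h) z
  + (m + c * (x - y + h)) / (x - y + h) * ev3 t y x z.
Proof.
move=> nz; rewrite !ev3_slice12 !mulr_sumr -big_split; apply: eq_bigr => k _ /=.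
rewrite !mulrA -mulrDl -actV //; congr (ev2 _ _ _ * _).
by apply/ffunP=> -[i j]; rewrite !ffunE.
Qed.

Lemma ev3_R13 t x y z : x - z + h != 0 -> ev3 (R13 R t) x y z =
  (x - z + h - m) / (x - z + h) * ev3 t (x + h) y (z - h)
  + (m + c * (x - z + h)) / (x - z + h) * ev3 t z y x.
Proof.
move=> nz; rewrite !ev3_slice13 !mulr_sumr -big_split; apply: eq_bigr => k _ /=.
rewrite !mulrA -mulrDl -actV //; congr (ev2 _ _ _ * _).
by apply/ffunP=> -[i j]; rewrite !ffunE.
Qed.

Lemma ev3_R23 t x y z : y - z + h != 0 -> ev3 (R23 R t) x y z =
  (y - z + h - m) / (y - z + h) * ev3 t x (y + h) (z - h)
  + (m + c * (y - z + h)) / (y - z + h) * ev3 t x z y.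
Proof.
move=> nz; rewrite !ev3_slice23 !mulr_sumr -big_split; apply: eq_bigr => k _ /=.
rewrite !mulrA -mulrDl -actV //; congr (ev2 _ _ _ * _).
by apply/ffunP=> -[i j]; rewrite !ffunE.
Qed.

(* Differences of the variables at which a denominator occurring in either side
   of the Yang-Baxter equation vanishes. *)
Definition singular : seq F := [:: - h; - (h + h)].

(* Proves x != 0 when x or -x equals, up to ring normalisation, a term that is
   nonzero by hypothesis. *)
Ltac nonsing :=
  match goal with |- is_true (?x != 0) =>
    match goal with H : is_true (?y != 0) |- _ =>
      first [ (suff -> : x = y by exact: H); ring
            | rewrite -oppr_eq0; (suff -> : - x = y by exact: H); ring ]
    end
  end.

(** Both sides are combinations of the values of t at the same six points, which are permutations of
    one another in the shifted variables; comparing coefficients is an identity of rational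
    functions. *)
Lemma ev3_modified_YB t x y z :
  x - y \notin singular -> x - z \notin singular -> y - z \notin singular ->
  ev3 (R12 R (R13 R (R23 R t))) x y z - ev3 (R23 R (R13 R (R12 R t))) x y z =
  - c ^+ 2 * (ev3 (R12 R t) y z x - ev3 (R23 R t) z x y).
Proof.
have sing w : w \notin singular -> w + h != 0 /\ w + (h + h) != 0.
  by rewrite !inE negb_or !addr_eq0 => /andP.
(* Up to sign, only the denominators x - y + h, x - z + 2h and y - z + h occur. *)
move=> /sing[nzxy _] /sing[_ nzxz] /sing[nzyz _].
have := ev3_R12 t; have := ev3_R23 t.
have := ev3_R13 (R12 R t); have := ev3_R13 (R23 R t).
have := ev3_R12 (R13 R (R23 R t)); have := ev3_R23 (R13 R (R12 R t)).
(* Abstracting the evaluations keeps unification from unfolding R12 etc. *)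
move: (ev3 (R12 R (R13 R (R23 R t)))) (ev3 (R23 R (R13 R (R12 R t)))).
move: (ev3 (R13 R (R23 R t))) (ev3 (R13 R (R12 R t))).
move: (ev3 (R12 R t)) (ev3 (R23 R t)) (ev3 t).
move=> f g e p q r s E1 E2 E3 E4 E5 E6.
rewrite E2 ?E3 ?E5; try nonsing.
rewrite E1 ?E4 ?E6; try nonsing.
(* Once opposite shifts cancel, equal values of t are the same atom for [field]. *)
rewrite !addrK !subrK; field.
all: try by nonsing.
by rewrite nzxy nzyz /=; apply/and3P; split; nonsing.
Qed.
End ShiftSwap.
End Evaluation.

(** * Vanishing outside finite sets in characteristic zero *)

Section InfiniteField.
Variable F : fieldType.
Hypothesis charF0 : [pchar F] =i pred0.

Lemma natr_inj_pchar0 : injective (fun k => k%:R : F).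
Proof.
move=> i j /=; wlog le_ij : i j / (i <= j)%N => [IH eq_ij|/eqP].
  by case/orP: (leq_total i j) => le_ij; [|symmetry]; apply: IH.
rewrite eq_sym -subr_eq0 -natrB // ((pcharf0P F).1 charF0) subn_eq0 => le_ji.
by apply/eqP; rewrite eqn_leq le_ij.
Qed.

(** Multiplied by the product of the X - a for a in [ls], p vanishes everywhere, in particular at
    more natural numbers than its degree allows. *)
Lemma poly_eq0_cofinite (p : {poly F}) (ls : seq F) :
  (forall x, x \notin ls -> p.[x] = 0) -> p = 0.
Proof.
move=> p0; pose q := p * \prod_(a <- ls) ('X - a%:P).
suff /eqP : q = 0.
  rewrite mulf_eq0 => /orP[/eqP //|].
  by rewrite (negPf (monic_neq0 (monic_prod_XsubC _ _ _))).
apply/eqP; apply: contraT => q_neq0.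
have /(max_poly_roots q_neq0) : all (root q) [seq k%:R | k <- iota 0 (size q)].
  apply/allP => x _; rewrite rootM root_prod_XsubC orbC.
  by case: (boolP (x \in ls)) => //= xls; rewrite /root p0.
rewrite size_map size_iota ltnn (map_inj_uniq natr_inj_pchar0) iota_uniq.
by move=> /(_ isT).
Qed.

Lemma power_sum_eq0 n (s : 'I_n -> F) (ls : seq F) :
  (forall x, x \notin ls -> \sum_i s i * x ^+ i = 0) -> forall i, s i = 0.
Proof.
move=> s0 i; have p0 : \sum_i s i *: 'X^i = 0 :> {poly F}.
  apply: (@poly_eq0_cofinite _ ls) => x xls.
  rewrite horner_sum -[RHS](s0 x xls).
  by apply: eq_bigr => j _; rewrite hornerZ hornerXn.
have := congr1 (fun p : {poly F} => p`_i) p0; rewrite /= coef0 coef_sum.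
rewrite (bigD1 i) //= coefZ coefXn eqxx mulr1 big1 ?addr0 // => j ji.
by rewrite coefZ coefXn eq_sym (negPf (ji : (j != i :> nat))) mulr0.
Qed.

(** The variables are removed one at a time: x is free, y avoids finitely many values depending on
    x, and z finitely many depending on x and y. *)
Lemma ev3_eq0 n (t : tensor3 F n) (ls : seq F) :
  (forall x y z, x - y \notin ls -> x - z \notin ls -> y - z \notin ls ->
    ev3 t x y z = 0) ->
  t = 0.
Proof.
move=> t0; apply/ffunP => -[[i j] k]; rewrite [RHS]ffunE.
have sub_notin x y : y \notin [seq x - l | l <- ls] -> x - y \notin ls.
  by apply: contra => xy; apply/mapP; exists (x - y) => //; rewrite subKr.
move: i; apply: (@power_sum_eq0 _ (fun i => t (i, j, k)) [::]) => x _.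
move: j; apply: (@power_sum_eq0 _ (fun j => \sum_i t (i, j, k) * x ^+ i)
  [seq x - l | l <- ls]) => y xy.
move: k; apply: (@power_sum_eq0 _
  (fun k => \sum_j (\sum_i t (i, j, k) * x ^+ i) * y ^+ j)
  ([seq x - l | l <- ls] ++ [seq y - l | l <- ls])) => z.
rewrite mem_cat negb_or => /andP[xz yz].
rewrite -[RHS](t0 x y z) ?sub_notin // ev3_slice12.
apply: eq_bigr => k _; congr (_ * _); rewrite /ev2 exchange_big.
apply: eq_bigr => j _; rewrite mulr_suml.
by apply: eq_bigr => i _; rewrite ffunE.
Qed.

Lemma modified_YB n h m c (R : 'End({ffun 'I_n * 'I_n -> F^o})) :
  shift_swap h m c R -> forall t,
  R12 R (R13 R (R23 R t)) - R23 R (R13 R (R12 R t)) =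
  - c ^+ 2 *: (P123 (R12 R t) - P213 (R23 R t)).
Proof.
move=> actR t; apply/eqP; rewrite -subr_eq0; apply/eqP.
apply: (@ev3_eq0 _ _ (singular h)) => x y z xy xz yz.
rewrite 2!ev3B ev3Z (ev3B (P123 _)) ev3_P123 ev3_P213.
by rewrite (ev3_modified_YB actR) // subrr.
Qed.

End InfiniteField.

(** * The operators R_c lie in the locus *)

Section Deformation.
Variables (F : fieldType) (n : nat) (h : F).
Hypothesis charF0 : [pchar F] =i pred0.

Definition delta2 i j : tensor2 F n.+1 := [ffun x => (x == (i, j))%:R].

Lemma ev2_delta i j a b : ev2 (delta2 i j) a b = a ^+ i * b ^+ j.
Proof.
rewrite /ev2 (bigD1 i) //= (bigD1 j) //= !big1 ?addr0.
- by rewrite ffunE eqxx mul1r.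
- move=> i' /negPf ne; rewrite big1 // => j' _.
  by rewrite ffunE xpair_eqE ne !mul0r.
by move=> j' /negPf ne; rewrite ffunE xpair_eqE ne andbF !mul0r.
Qed.

(** The constant polynomial 1 is an eigenvector with eigenvalue 1 + c, read off at a point where a -
    b + h = 1. *)
Lemma Rdeform_neq0 c : 1 + c != 0 -> Rdeform n.+1 h c != 0.
Proof.
apply: contraNneq => R0.
have := ev2_Rdeform h c (delta2 0 0) (1 - h) 0.
rewrite R0 lfunE /= !ev2_delta !expr0.
have -> : ev2 (0 : tensor2 F n.+1) (1 - h) 0 = 0.
  by rewrite -(scale0r (0 : tensor2 F n.+1)) ev2Z mul0r.
by move=> E; apply/eqP; rewrite -[RHS](mulr0 (1 - h - 0 + h)) E; ring.
Qed.

Lemma Rdeform_mQYBE c : c != 0 -> 1 + c != 0 -> mQYBE (Rdeform n.+1 h c).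
Proof.
move=> c0 c1; split; first exact: Rdeform_neq0.
exists (- c ^+ 2); first by rewrite oppr_eq0 expf_neq0.
exact: (modified_YB charF0 (ev2_Rdeform h c)).
Qed.

End Deformation.

(** On the line A + cB, p restricts to a polynomial q in the single variable c. *)
Lemma meval_pencil (F : fieldType) (charF0 : [pchar F] =i pred0)
    (W : vectType F) (p : {mpoly F[\dim {:W}]}) (A B : W) (ls : seq F) :
  (forall c, c \notin ls ->
     p.@[fun i => coord (vbasis {:W}) i (A + c *: B)] = 0) ->
  p.@[fun i => coord (vbasis {:W}) i A] = 0.
Proof.
move=> p0; pose v i := coord (vbasis {:W}) i.
pose q := mmap (polyC : F -> {poly F})
  (fun i => (v i A)%:P + 'X * (v i B)%:P) p.
have qE c : q.[c] = p.@[fun i => v i (A + c *: B)].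
  rewrite mevalE /q /mmap horner_sum; apply: eq_bigr => m _.
  rewrite hornerM hornerC horner_prod; congr (_ * _); apply: eq_bigr => i _.
  by rewrite horner_exp !hornerE /v linearD linearZ.
have q_eq0 : q = 0.
  by apply: (poly_eq0_cofinite charF0 (ls := ls)) => c /p0; rewrite qE.
by have := qE 0; rewrite scale0r addr0 q_eq0 horner0.
Qed.

(** * No multiple of R_p lies in the locus *)

Section Scaling.
Variables (F : fieldType) (n : nat) (R : 'End({ffun 'I_n * 'I_n -> F^o})).
Implicit Types (k l : F) (t : tensor3 F n).

Lemma R12Z k l t : R12 (k *: R) (l *: t) = (k * l) *: R12 R t.
Proof.
apply/ffunP => -[[i j] m]; rewrite !ffunE scale_lfunE ffunE -scalerA.
have -> : [ffun y : 'I_n * 'I_n => (l *: t) (y.1, y.2, m)] =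
    l *: [ffun y => t (y.1, y.2, m)].
  by apply/ffunP => y; rewrite !ffunE.
by rewrite linearZ ffunE.
Qed.

Lemma R13Z k l t : R13 (k *: R) (l *: t) = (k * l) *: R13 R t.
Proof.
apply/ffunP => -[[i j] m]; rewrite !ffunE scale_lfunE ffunE -scalerA.
have -> : [ffun y : 'I_n * 'I_n => (l *: t) (y.1, j, y.2)] =
    l *: [ffun y => t (y.1, j, y.2)].
  by apply/ffunP => y; rewrite !ffunE.
by rewrite linearZ ffunE.
Qed.

Lemma R23Z k l t : R23 (k *: R) (l *: t) = (k * l) *: R23 R t.
Proof.
apply/ffunP => -[[i j] m]; rewrite !ffunE scale_lfunE ffunE -scalerA.
have -> : [ffun y : 'I_n * 'I_n => (l *: t) (i, y.1, y.2)] =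
    l *: [ffun y => t (i, y.1, y.2)].
  by apply/ffunP => y; rewrite !ffunE.
by rewrite linearZ ffunE.
Qed.

(** The left side of the modified equation is cubic in R, so it vanishes for kR too; the right side
    is lk times the difference of the two terms. *)
Lemma mQYBE_scale_YB k : k != 0 -> mQYBE (k *: R) ->
  (forall t, R12 R (R13 R (R23 R t)) = R23 R (R13 R (R12 R t))) ->
  forall t, P123 (R12 R t) = P213 (R23 R t).
Proof.
move=> k0 [_ [l l0 mYB]] YB t; have := mYB t.
have R12l s : R12 (k *: R) s = k *: R12 R s.
  by rewrite -{1}[s]scale1r R12Z mulr1.
have R23l s : R23 (k *: R) s = k *: R23 R s.
  by rewrite -{1}[s]scale1r R23Z mulr1.
rewrite (R23l t) (R12l t) !(R12Z, R13Z, R23Z) YB subrr => /esym/eqP.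
have -> : P123 (k *: R12 R t) = k *: P123 (R12 R t).
  by apply/ffunP => -[[i j] m]; rewrite !ffunE.
have -> : P213 (k *: R23 R t) = k *: P213 (R23 R t).
  by apply/ffunP => -[[i j] m]; rewrite !ffunE.
rewrite -scalerBr scalerA scaler_eq0 mulf_eq0 (negPf l0) (negPf k0) subr_eq0.
by move/eqP.
Qed.

End Scaling.

Definition delta3 (F : fieldType) n i j k : tensor3 F n.+1 :=
  [ffun x => (x == (i, j, k))%:R].

Lemma ev3_delta (F : fieldType) n i j k a b c :
  ev3 (delta3 F (n := n) i j k) a b c = a ^+ i * b ^+ j * c ^+ k.
Proof.
rewrite ev3_slice12 (bigD1 k) //= big1 ?addr0 => [|l /negPf ne].
  rewrite -ev2_delta; congr (ev2 _ _ _ * _).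
  by apply/ffunP => -[x y]; rewrite !ffunE !xpair_eqE eqxx andbT.
rewrite /ev2 big1 ?mul0r // => x _; rewrite big1 // => y _.
by rewrite !ffunE !xpair_eqE ne andbF !mul0r.
Qed.

(** With m = hn, R_p sends z_1 to z_1 + h - m and R_23 fixes z_1, so on z_1 the equality P_123 R_12
    = P_213 R_23 would read z_2 + h - m = z_3. *)
Lemma Rp_scale_not_mQYBE (F : fieldType) (charF0 : [pchar F] =i pred0) (n : nat)
    (h k : F) : k != 0 -> ~ mQYBE (k *: Rp n.+2 h).
Proof.
move=> k0 mYB; set R := Rp _ _ in mYB.
have actR : shift_swap h (h * n.+2%:R) 0 R.
  by move=> u a b; rewrite ev2_Rp mul0r addr0.
have YB t : R12 R (R13 R (R23 R t)) = R23 R (R13 R (R12 R t)).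
  apply/eqP; rewrite -subr_eq0 (modified_YB charF0 actR).
  by rewrite expr0n oppr0 scale0r.
have m_eq w : w != 0 -> h * n.+2%:R = w.
  move=> w0; pose z1 := delta3 F (Ordinal (isT : (1 < n.+2)%N)) 0 0.
  have := mQYBE_scale_YB k0 mYB YB z1.
  (* At this point the denominators are w and 1, and the two sides are h - m and h - w. *)
  move=> /(congr1 (fun t => ev3 t (1 - h) 0 (h - w))).
  have w_eq : 0 - (h - w) + h = w by ring.
  have one_eq : 1 - h - 0 + h = 1 by ring.
  rewrite ev3_P123 ev3_P213 (ev3_R12 actR) ?w_eq //.
  rewrite (ev3_R23 actR) one_eq ?oner_neq0 //.
  rewrite !ev3_delta !expr0 !expr1 !divr1; move: (h * _) => m E.
  apply/oppr_inj/(addrI h).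
  have -> : h - w =
      (1 - m) * ((h - w) * 1 * 1) + (m + 0 * 1) * ((h - w) * 1 * 1).
    by ring.
  by rewrite -E; field.
have nz j : j.+1%:R != 0 :> F by rewrite ((pcharf0P F).1 charF0).
(* Taking w = 1 and w = 2 gives 1 = 2. *)
by have /(natr_inj_pchar0 charF0) :=
  etrans (esym (m_eq _ (nz 0))) (m_eq _ (nz 1)).
Qed.

Theorem mainTheorem4 (F : closedFieldType) (charF0 : [pchar F] =i pred0)
    (n : nat) (n_ge2 : (2 <= n)%N) (h : F) :
  boundary_solution (Rp n h).
Proof.
case: n n_ge2 => [|[|n]] // _.
pose R c := Rdeform n.+2 h c.
have R0E : R 0 = Rp n.+2 h by rewrite /R /Rdeform scale0r addr0.
have dimR c : 1 + c != 0 -> \dim <[R c]> == 1%N.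
  by move=> c1; rewrite dim_vline Rdeform_neq0.
have nz0 : 1 + 0 != 0 :> F by rewrite addr0 oner_neq0.
exists (exist _ <[R 0%R]>%VS (dimR 0 nz0)); split.
- by rewrite /= R0E.
- move=> B [S [_ BS]] sub; apply/BS => p Sp _ /vlineP[k ->].
  rewrite /R /Rdeform scale0r addr0.
  (* The pencil through kR_0 in direction kP consists of the kR_c. Excluded are c = 0, where lambda
     = - c^2 vanishes, and c = -1, where the eigenvalue 1 + c does. *)
  apply: (meval_pencil charF0 (B := k *: linfun (@flip F n.+2))
    (ls := [:: 0; -1])) => c.
  rewrite !inE negb_or => /andP[c0 cN1].
  have c1 : 1 + c != 0 by rewrite addrC addr_eq0.
  have /sub/BS : mQYBE_locus (exist _ <[R c]>%VS (dimR c c1)).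
    by exists (R c) => //; apply: Rdeform_mQYBE.
  move=> /(_ p Sp); apply; apply/vlineP; exists k.
  by rewrite scalerDr !scalerA mulrC.
- move=> [R' /= E mR'].
  (* A representative of the class in the locus is a multiple kR_p, with k nonzero because it is
     itself nonzero. *)
  have /vlineP[k R'E] : R' \in <[R 0%R]>%VS by rewrite E memv_line.
  case: (mR') => R'0 _; apply: (@Rp_scale_not_mQYBE _ charF0 n h k); last first.
    by rewrite -R0E -R'E.
  by apply: contraNneq R'0 => k0; rewrite R'E k0 scale0r.
Qed.
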